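(* Let $\Delta t>0$ and let $(f^n,r^n)_{n\ge 0}$ be produced by the scheme SAV-2nd: $r^0=\sqrt{H(f^0)}$; $(f^1,r^1)$ is obtained from $(f^0,r^0)$ by one step of the first order scheme $$\frac{f^{1}-f^0}{\Delta t}=\frac{r^{1}}{\sqrt{H(f^0)}}\,Q(f^0),\qquad \frac{r^{1}-r^0}{\Delta t}=\frac{1}{2\sqrt{H(f^0)}}\int_\Omega \log f^0\,\frac{f^{1}-f^0}{\Delta t}\,dv;$$ and for all $n\ge 1$, $$\frac{3f^{n+1}-4f^n+f^{n-1}}{2\Delta t}=\frac{r^{n+1}}{\sqrt{H^{n+1,*}}}\,Q(f^{n+1,*}),$$ $$\frac{3r^{n+1}-4r^n+r^{n-1}}{2\Delta t}=\frac{1}{2\sqrt{H^{n+1,*}}}\int_\Omega\log f^{n+1,*}\,\frac{3f^{n+1}-4f^n+f^{n-1}}{2\Delta t}\,dv,$$ where $H^{n+1,*}=H(f^{n+1,*})>0$ and $f^{n+1,*}$ is an explicit second-order approximation of $f(t^{n+1})$ computed from previous iterates. Then for every step size $\Delta t>0$: (1) (conservation of mass, momentum and energy) for all $n\ge 0$, $\displaystyle\int_\Omega f^{n+1}(1,v,|v|^2)^T\,dv=\int_\Omega f^n(1,v,|v|^2)^T\,dv$; (2) (modified entropy dissipation) for all $n\ge 1$, with $\tilde H^n=\frac12(r^n)^2+\frac12(2r^n-r^{n-1})^2$, $$\tilde H^{n+1}-\tilde H^n=-\frac12(r^{n+1}-2r^n+r^{n-1})^2+\frac{\Delta t\,(r^{n+1})^2}{H^{n+1,*}}\int_\Omega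 Q(f^{n+1,*})\log f^{n+1,*}\,dv\le 0.$$
   Context: The scheme is a time discretization of the spatially homogeneous kinetic equation $\partial_t f=Q(f)$, $f=f(t,v)$. The velocity variable $v$ is kept continuous and ranges over a bounded (truncated) domain $\Omega\subset\mathbb{R}^d$; each $f^n$ and $f^{n+1,*}$ is a real-valued function of $v\in\Omega$ and each $r^n$ is a real number. The collision operator $Q$ (mapping functions on $\Omega$ to functions on $\Omega$) is assumed to satisfy, for every function $f$ to which it is applied: - conservation: $\int_\Omega Q(f)\,dv=0$, $\int_\Omega Q(f)\,v\,dv=0$, $\int_\Omega Q(f)\,|v|^2\,dv=0$; - H-theorem: $\int_\Omega Q(f)\log f\,dv\le 0$. $H(f)=\int_\Omega f\log f\,dv+C$, where the real constant $C$ is chosen so that $H$ is positive for the functions at which it is evaluated. The function $f^{n+1,*}$ is any explicit approximation of $f(t^{n+1})$, $t^{n+1}=(n+1)\Delta t$, of order $\mathcal{O}(\Delta t^2)$, computed from already known iterates (for example the Adams–Bashforth extrapolation $f^{n+1,*}=2f^n-f^{n-1}$); the order of approximation is a design requirement for accuracy, and $f^{n+1,*}$ may be treated as a given function at step $n$. It is a standing assumption that the functions inside logarithms are such that the logarithms are defined, and that all integrals appearing are well defined and finite. *)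

(* Defs.v *)
From HB Require Import structures.
From mathcomp Require Import all_boot all_order all_algebra.
From mathcomp Require Import all_classical all_reals all_analysis.

Set Implicit Arguments.
Unset Strict Implicit.
Unset Printing Implicit Defensive.

Import Order.TTheory GRing.Theory Num.Theory.
Import numFieldNormedType.Exports.

Local Open Scope classical_set_scope.
Local Open Scope ring_scope.

(** The analysis library has Lebesgue measure on R only.  R^d is the type of
    d-tuples of reals with the product (= Borel) sigma-algebra, and Lebesgue
    measure is built by recursion on d: Dirac mass at the empty tuple for
    d = 0, image of (Lebesgue on R) x (Lebesgue on R^d) under (x, v) |-> x :: v
    for d + 1. [lebesgue_Rn_box] gives its value on boxes. *)

Notation Rn R d := (d.-tuple (measurableTypeR R)).

Section lebesgue_Rn.
Variable R : realType.

Definition Rn_cons d (p : measurableTypeR R * Rn R d) : Rn R d.+1 :=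
  [tuple of p.1 :: p.2].

Lemma measurable_Rn_cons d : measurable_fun setT (@Rn_cons d).
Proof.
exact: (@measurable_cons _ _ _ _ fst d snd measurable_fst measurable_snd).
Qed.

Definition Rn_uncons d (v : Rn R d.+1) : measurableTypeR R * Rn R d :=
  (thead v, [tuple of behead v]).

Lemma measurable_Rn_uncons d : measurable_fun setT (@Rn_uncons d).
Proof.
apply: measurable_fun_pair; last exact: measurable_behead.
exact: (@measurable_tnth _ (measurableTypeR R) d.+1 ord0).
Qed.

Lemma Rn_consK d : cancel (@Rn_cons d) (@Rn_uncons d).
Proof. by case=> x v; congr pair; apply: val_inj. Qed.

Lemma Rn_unconsK d : cancel (@Rn_uncons d) (@Rn_cons d).
Proof. by move=> v; rewrite [RHS]tuple_eta. Qed.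

Section step.
Local Open Scope ereal_scope.
Variables (d : nat) (m : {sigma_finite_measure set (Rn R d) -> \bar R}).

Definition lebesgue_Rn_succ : set (Rn R d.+1) -> \bar R :=
  pushforward (lebesgue_measure \x m) (@Rn_cons d).

Let measurable_preimage A : measurable A -> measurable (@Rn_cons d @^-1` A).
Proof.
by move=> mA; rewrite -[X in measurable X]setTI; exact: measurable_Rn_cons.
Qed.

Let succ0 : lebesgue_Rn_succ set0 = 0.
Proof. by rewrite /lebesgue_Rn_succ /pushforward preimage_set0 measure0. Qed.

Let succ_ge0 A : 0 <= lebesgue_Rn_succ A.
Proof. by rewrite /lebesgue_Rn_succ /pushforward; exact: measure_ge0. Qed.

Let succ_sigma_additive : semi_sigma_additive lebesgue_Rn_succ.
Proof.
move=> F mF tF mUF; rewrite /lebesgue_Rn_succ /pushforward preimage_bigcup.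
apply: measure_semi_sigma_additive.
- by move=> n; exact: measurable_preimage.
- apply/trivIsetP => /= i j _ _ ij; rewrite -preimage_setI.
  by move/trivIsetP : tF => /(_ _ _ _ _ ij) ->//; rewrite preimage_set0.
- by rewrite -preimage_bigcup; exact: measurable_preimage.
Qed.

HB.instance Definition _ := isMeasure.Build _ _ _ lebesgue_Rn_succ
  succ0 succ_ge0 succ_sigma_additive.

Let succ_sigma_finite : sigma_finite setT lebesgue_Rn_succ.
Proof.
have /sigma_finiteP[F [TF ndF Foo]] := sigma_finiteT (@lebesgue_measure R).
have /sigma_finiteP[G [TG ndG Goo]] := sigma_finiteT m.
exists (fun k => @Rn_uncons d @^-1` (F k `*` G k)).
  rewrite -preimage_bigcup (_ : \bigcup_k _ = setT) ?preimage_setT//.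
  rewrite -setXTT TF TG predeqE => -[x y]; split.
    by move=> [n _ []/= ? ?]; split; exists n.
  move=> [/= [n _ Fnx] [k _ Gky]]; exists (maxn n k) => //; split.
  - by move: x Fnx; exact/subsetPset/ndF/leq_maxl.
  - by move: y Gky; exact/subsetPset/ndG/leq_maxr.
move=> k; have [mF Fk] := Foo k; have [mG Gk] := Goo k; split.
  rewrite -[X in measurable X]setTI.
  by apply: measurable_Rn_uncons => //; exact: measurableX.
rewrite /lebesgue_Rn_succ /pushforward -comp_preimage.
rewrite (_ : _ \o _ = id); last by apply/funext => p /=; rewrite Rn_consK.
by rewrite preimage_id product_measure1E// lte_mul_pinfty// ge0_fin_numE.
Qed.

HB.instance Definition _ := Measure_isSigmaFinite.Build _ _ _ lebesgue_Rn_succ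
  succ_sigma_finite.

End step.

Fixpoint lebesgue_Rn (d : nat) : {sigma_finite_measure set (Rn R d) -> \bar R} :=
  match d with
  | 0 => @dirac _ (Rn R 0) [tuple] R
  | d'.+1 => lebesgue_Rn_succ (lebesgue_Rn d')
  end.

Lemma lebesgue_Rn_box d (A : 'I_d -> set (measurableTypeR R)) :
  (forall i, measurable (A i)) ->
  lebesgue_Rn d [set v | forall i, A i (tnth v i)] =
  (\prod_(i < d) lebesgue_measure (A i))%E.
Proof.
elim: d A => [|d IH] A mA.
  by rewrite big_ord0 /= diracE mem_set// => -[].
rewrite big_ord_recl -IH//= /lebesgue_Rn_succ /pushforward.
have mB : measurable [set v : Rn R d | forall i, A (lift ord0 i) (tnth v i)].
  rewrite (_ : [set v | _] =
    \big[setI/setT]_(i < d) ((fun v => tnth v i) @^-1` A (lift ord0 i))).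
    apply: bigsetI_measurable => i _; rewrite -[X in measurable X]setTI.
    exact: (@measurable_tnth _ (measurableTypeR R) d i).
  apply/seteqP; split=> [v vA|v].
    by elim/big_ind : _ => // i _; exact: vA.
  by rewrite -bigcap_seq/= => vA i; apply: (vA i); rewrite /= mem_index_enum.
rewrite -product_measure1E//; congr product_measure1.
apply/seteqP; split=> [[x v] /= h|[x v] /= [hx hv] i].
  by split=> [|i]; [exact: (h ord0)|have := h (lift ord0 i); rewrite tnthS].
by case: (unliftP ord0 i) => [j|] ->; rewrite ?tnthS.
Qed.

End lebesgue_Rn.

(** A function on Omega is represented by a total function on R^d of which
    only the values on Omega matter. *)

Section kinetic.
Variables (R : realType) (d : nat) (Omega : set (Rn R d)).

Local Notation mu := (lebesgue_Rn R d).
Implicit Types f g : Rn R d -> R.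

Definition coord (v : Rn R d) (i : 'I_d) : R := tnth v i.

Definition sqnorm (v : Rn R d) : R := \sum_(i < d) coord v i ^+ 2.

Definition bounded_domain : Prop :=
  measurable Omega /\ exists M : R, forall v, Omega v -> sqnorm v <= M.

Definition integrable_on g : Prop := mu.-integrable Omega (EFin \o g).

Definition mass g : R := \int[mu]_(v in Omega) g v.

Definition momentum g : 'rV[R]_d :=
  \row_(i < d) \int[mu]_(v in Omega) (g v * coord v i).

Definition energy g : R := \int[mu]_(v in Omega) (g v * sqnorm v).

Definition finite_moments g : Prop :=
  [/\ integrable_on g,
      forall i, integrable_on (fun v => g v * coord v i) &
      integrable_on (fun v => g v * sqnorm v)].

(** integrability is required separately since [\int] is total *)
Definition entropy_admissible f : Prop :=
  (forall v, Omega v -> 0 < f v) /\ integrable_on (fun v => f v * ln (f v)).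

Definition entropy (C : R) f : R :=
  \int[mu]_(v in Omega) (f v * ln (f v)) + C.

(** [D] is the class of functions to which [Q] may be applied *)
Record collision_operator (D : set (Rn R d -> R))
    (Q : (Rn R d -> R) -> Rn R d -> R) : Prop := CollisionOperator {
  collision_moments : forall f, D f -> finite_moments (Q f) ;
  collision_mass : forall f, D f -> mass (Q f) = 0 ;
  collision_momentum : forall f, D f -> momentum (Q f) = 0 ;
  collision_energy : forall f, D f -> energy (Q f) = 0 ;
  collision_production : forall f, D f ->
    integrable_on (fun v => Q f v * ln (f v)) ;
  collision_H_theorem : forall f, D f ->
    \int[mu]_(v in Omega) (Q f v * ln (f v)) <= 0 }.

Section scheme.
Variables (Q : (Rn R d -> R) -> Rn R d -> R) (C dt : R).

Definition sav1_step f0 (r0 : R) f1 (r1 : R) : Prop :=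
  (forall v, Omega v ->
     (f1 v - f0 v) / dt = r1 / Num.sqrt (entropy C f0) * Q f0 v) /\
  (r1 - r0) / dt =
    1 / (2 * Num.sqrt (entropy C f0)) *
    \int[mu]_(v in Omega) (ln (f0 v) * ((f1 v - f0 v) / dt)).

(** one step from (f, r)^(n-1), (f, r)^n to (f, r)^(n+1), where [fs] is the
    extrapolated function f^(n+1,star) *)
Definition sav2_step fs f0 (r0 : R) f1 (r1 : R) f2 (r2 : R) : Prop :=
  (forall v, Omega v ->
     (3 * f2 v - 4 * f1 v + f0 v) / (2 * dt) =
     r2 / Num.sqrt (entropy C fs) * Q fs v) /\
  (3 * r2 - 4 * r1 + r0) / (2 * dt) =
    1 / (2 * Num.sqrt (entropy C fs)) *
    \int[mu]_(v in Omega)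
      (ln (fs v) * ((3 * f2 v - 4 * f1 v + f0 v) / (2 * dt))).

Definition sav2_scheme (fstar f : nat -> Rn R d -> R) (r : nat -> R) : Prop :=
  [/\ r 0 = Num.sqrt (entropy C (f 0)),
      sav1_step (f 0) (r 0) (f 1) (r 1) &
      forall n, (1 <= n)%N ->
        sav2_step (fstar n.+1) (f n.-1) (r n.-1) (f n) (r n)
          (f n.+1) (r n.+1)].

End scheme.

End kinetic.

Definition modified_entropy (R : realType) (r : nat -> R) (n : nat) : R :=
  1 / 2 * r n ^+ 2 + 1 / 2 * (2 * r n - r n.-1) ^+ 2.

(* Main.v *)
Require Import Defs.
From HB Require Import structures.
From mathcomp Require Import all_boot all_order all_algebra.
From mathcomp Require Import all_classical all_reals all_analysis.
From mathcomp Require Import ring lra.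

(** Conservation: on Omega the increments g_n = f^(n+1) - f^n satisfy
    g_0 = k_0 Q(f^0), and, because 3 f^(n+2) - 4 f^(n+1) + f^n =
    3 g_(n+1) - g_n, also g_(n+1) = g_n / 3 + k_n Q(f^(n+2,star)), with real
    factors k_n that do not depend on v. Hence every g_n lies, on Omega, in the
    linear span of values of Q. The functions whose integral against a
    collision invariant (1, v_i or |v|^2) vanishes form a linear space
    ([null_moment_lincomb]) that contains the values of Q, so all the g_n have
    null moments ([sav2_increment_null]).

    Entropy: substituting the equation for f into the equation for r turns the
    latter into a closed recursion ([sav2_step_auxiliary]),
    3 r^(n+1) - 4 r^n + r^(n-1) = dt r^(n+1) P / H with P the entropy
    production and H the entropy at the extrapolated function: the two factors
    1 / sqrt H combine. Multiplying by r^(n+1) and using the G-stability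
    identity of the BDF2 difference ([bdf2_identity]) yields the dissipation
    formula; its right-hand side is minus a square plus a nonnegative
    multiple of P, and P <= 0 by the H-theorem, so the decay holds for every
    positive dt. *)

Set Implicit Arguments.
Unset Strict Implicit.
Unset Printing Implicit Defensive.

Import Order.TTheory GRing.Theory Num.Theory.
Import numFieldNormedType.Exports.

Local Open Scope classical_set_scope.
Local Open Scope ring_scope.

Section null_moment.
Variables (R : realType) (d : nat) (Omega : set (Rn R d)) (w : Rn R d -> R).
Implicit Types f g h q : Rn R d -> R.

Local Notation mu := (lebesgue_Rn R d).

Definition moment g : R := \int[mu]_(v in Omega) (g v * w v).

(** Integrability is part of the definition: without it the functions of
    vanishing integral would not form a linear space. *)
Definition null_moment g : Prop :=
  integrable_on Omega (fun v => g v * w v) /\ moment g = 0.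

Hypothesis mOmega : measurable Omega.

Lemma integrable_moment_lincomb a b g q :
  integrable_on Omega (fun v => g v * w v) ->
  integrable_on Omega (fun v => q v * w v) ->
  integrable_on Omega (fun v => (a * g v + b * q v) * w v).
Proof.
move=> ig iq.
have := integrableD mOmega (integrableZl mOmega a ig)
  (integrableZl mOmega b iq).
apply: eq_integrable => // v _ /=.
by rewrite -!EFinM -EFinD mulrDl !mulrA.
Qed.

Lemma moment_lincomb a b g q :
  integrable_on Omega (fun v => g v * w v) ->
  integrable_on Omega (fun v => q v * w v) ->
  moment (fun v => a * g v + b * q v) = a * moment g + b * moment q.
Proof.
move=> ig iq; rewrite /moment -!RintegralZl// -RintegralD//.
- by apply: eq_Rintegral => v _; rewrite mulrDl !mulrA.
- exact: (integrableZl mOmega a ig).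
- exact: (integrableZl mOmega b iq).
Qed.

Lemma null_moment_lincomb a b g q h :
  null_moment g -> null_moment q ->
  (forall v, Omega v -> h v = a * g v + b * q v) -> null_moment h.
Proof.
move=> [ig g0] [iq q0] hE; split.
  have := integrable_moment_lincomb a b ig iq.
  by apply: eq_integrable => // v /set_mem Ov /=; rewrite hE.
have <- : moment (fun v => a * g v + b * q v) = moment h.
  by apply: eq_Rintegral => v /set_mem Ov /=; rewrite hE.
by rewrite moment_lincomb// g0 q0 !mulr0 addr0.
Qed.

Lemma null_moment_increment f g :
  integrable_on Omega (fun v => f v * w v) ->
  integrable_on Omega (fun v => g v * w v) ->
  null_moment (fun v => g v - f v) -> moment g = moment f.
Proof.
move=> jf jg [_].
have -> : (fun v => g v - f v) = (fun v => 1 * g v + -1 * f v).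
  by apply/funext => v; ring.
by rewrite moment_lincomb// mul1r mulN1r => /eqP; rewrite subr_eq0 => /eqP.
Qed.

End null_moment.

Section scheme.
Variables (R : realType) (d : nat) (Omega : set (Rn R d)).
Variables (Q : (Rn R d -> R) -> Rn R d -> R) (C dt : R).
Hypothesis mOmega : measurable Omega.
Hypothesis dt_neq0 : dt != 0.
Implicit Types w fs : Rn R d -> R.

Local Notation mu := (lebesgue_Rn R d).

(** In terms of increments the BDF2 difference is 3 g_(n+1) - g_n, so a step
    gives g_(n+1) = (g_n + 2 dt k Q(fstar)) / 3 and induction on n applies to
    the increments, where the densities themselves would need two steps. *)
Lemma sav2_increment_null w (fstar f : nat -> Rn R d -> R) (r : nat -> R) :
  null_moment Omega w (Q (f 0%N)) ->
  (forall n, (1 <= n)%N -> null_moment Omega w (Q (fstar n.+1))) ->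
  sav2_scheme Omega Q C dt fstar f r ->
  forall n, null_moment Omega w (fun v => f n.+1 v - f n v).
Proof.
move=> Q0 Qs [_ [fE _] stepE]; elim=> [|n IHn].
  set k := r 1%N / Num.sqrt (entropy Omega C (f 0%N)).
  apply: (null_moment_lincomb (a := 0) (b := dt * k) mOmega Q0 Q0) => v Ov.
  by rewrite mul0r add0r -mulrA -fE// mulrC divfK.
have [fSE _] := stepE n.+1 isT.
set k := r n.+2 / Num.sqrt (entropy Omega C (fstar n.+2)).
apply: (null_moment_lincomb (a := 3^-1) (b := 2 * dt / 3 * k) mOmega IHn
  (Qs n.+1 isT)) => v Ov.
have := fSE v Ov; rewrite -/k /= -mulrA => <-.
by field.
Qed.

Lemma sav2_moment_conserved w (D : set (Rn R d -> R))
    (fstar f : nat -> Rn R d -> R) (r : nat -> R) :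
  (forall g, D g -> null_moment Omega w (Q g)) ->
  D (f 0%N) -> (forall n, (1 <= n)%N -> D (fstar n.+1)) ->
  (forall n, integrable_on Omega (fun v => f n v * w v)) ->
  sav2_scheme Omega Q C dt fstar f r ->
  forall n, moment Omega w (f n.+1) = moment Omega w (f n).
Proof.
move=> Qnull D0 Ds intf scheme n; apply: null_moment_increment => //.
apply: sav2_increment_null scheme n; first exact: Qnull.
by move=> n n_ge1; exact/Qnull/Ds.
Qed.

Lemma sav2_step_auxiliary fs f0 r0 f1 r1 f2 r2 :
  integrable_on Omega (fun v => Q fs v * ln (fs v)) ->
  0 < entropy Omega C fs ->
  sav2_step Omega Q C dt fs f0 r0 f1 r1 f2 r2 ->
  3 * r2 - 4 * r1 + r0 =
    dt * r2 / entropy Omega C fs *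
    \int[mu]_(v in Omega) (Q fs v * ln (fs v)).
Proof.
move=> iP H_gt0 [fE rE]; set P := Rintegral _ _ _.
set H := entropy Omega C fs in H_gt0 fE rE *; set s := Num.sqrt H in fE rE.
have s_neq0 : s != 0 by rewrite gt_eqF// sqrtr_gt0.
have HE : H = s ^+ 2 by rewrite sqr_sqrtr// ltW.
have rE' : (3 * r2 - 4 * r1 + r0) / (2 * dt) = 1 / (2 * s) * (r2 / s * P).
  rewrite rE; congr (_ * _); rewrite -RintegralZl//.
  apply: eq_Rintegral => v /set_mem Ov /=; rewrite fE//; ring.
rewrite -[LHS](@divfK _ (2 * dt)) ?mulf_neq0// rE' HE; field.
by rewrite s_neq0.
Qed.

End scheme.

(** The left-hand side is r2 times the BDF2 difference; the right-hand side is
    the increment of the quadratic form (x, y) |-> (y^2 + (2 y - x)^2) / 2 from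
    (r0, r1) to (r1, r2), plus the numerical dissipation. *)
Lemma bdf2_identity (R : realType) (r0 r1 r2 : R) :
  r2 * (3 * r2 - 4 * r1 + r0) =
  (1 / 2 * r2 ^+ 2 + 1 / 2 * (2 * r2 - r1) ^+ 2) -
  (1 / 2 * r1 ^+ 2 + 1 / 2 * (2 * r1 - r0) ^+ 2) +
  1 / 2 * (r2 - 2 * r1 + r0) ^+ 2.
Proof. by field. Qed.

Theorem theorem2p2 (R : realType) (d : nat) (Omega : set (Rn R d))
  (D : set (Rn R d -> R)) (Q : (Rn R d -> R) -> Rn R d -> R) (C dt : R)
  (fstar f : nat -> Rn R d -> R) (r : nat -> R)
  (hOmega : bounded_domain Omega)
  (hQ : collision_operator Omega D Q)
  (hdt : 0 < dt)
  (hD0 : D (f 0%N))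
  (hDstar : forall n, (1 <= n)%N -> D (fstar n.+1))
  (hadm0 : entropy_admissible Omega (f 0%N))
  (hadmstar : forall n, (1 <= n)%N -> entropy_admissible Omega (fstar n.+1))
  (hmoments : forall n, finite_moments Omega (f n))
  (hH0 : 0 < entropy Omega C (f 0%N))
  (hHstar : forall n, (1 <= n)%N -> 0 < entropy Omega C (fstar n.+1))
  (hscheme : sav2_scheme Omega Q C dt fstar f r) :
  (forall n,
     [/\ mass Omega (f n.+1) = mass Omega (f n),
         momentum Omega (f n.+1) = momentum Omega (f n) &
         energy Omega (f n.+1) = energy Omega (f n)]) /\
  (forall n, (1 <= n)%N ->
     modified_entropy r n.+1 - modified_entropy r n =
       - (1 / 2) * (r n.+1 - 2 * r n + r n.-1) ^+ 2
       + dt * r n.+1 ^+ 2 / entropy Omega C (fstar n.+1) *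
         \int[lebesgue_Rn R d]_(v in Omega)
           (Q (fstar n.+1) v * ln (fstar n.+1 v)) /\
     modified_entropy r n.+1 - modified_entropy r n <= 0).
Proof.
have [mOmega _] := hOmega; have dt_neq0 : dt != 0 by rewrite gt_eqF.
split=> [n|n n_ge1].
  split.
  - have massE g : mass Omega g = moment Omega (fun=> 1) g.
      by apply: eq_Rintegral => v _; rewrite mulr1.
    have mul1E g : (fun v => g v * 1) = g.
      by apply/funext => v; rewrite mulr1.
    rewrite !massE; apply: (sav2_moment_conserved mOmega dt_neq0 _ hD0
      hDstar _ hscheme) => //.
      move=> g Dg; split; last by rewrite -massE (collision_mass hQ).
      by rewrite mul1E; case: (collision_moments hQ Dg).
    by move=> m; rewrite mul1E; case: (hmoments m).
  - apply/rowP => i.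
    have momentumE g :
      momentum Omega g 0 i = moment Omega (fun v => Defs.coord v i) g.
      by rewrite mxE.
    rewrite !momentumE; apply: (sav2_moment_conserved mOmega dt_neq0 _ hD0
      hDstar _ hscheme) => //.
      move=> g Dg; split; first by case: (collision_moments hQ Dg).
      by rewrite -momentumE (collision_momentum hQ Dg) mxE.
    by move=> m; case: (hmoments m).
  - apply: (sav2_moment_conserved (w := @sqnorm R d) mOmega dt_neq0 _
      hD0 hDstar _ hscheme) => //.
      move=> g Dg; split; first by case: (collision_moments hQ Dg).
      exact: (collision_energy hQ Dg).
    by move=> m; case: (hmoments m).
have [_ _ /(_ n n_ge1) step] := hscheme.
have Ds := hDstar n n_ge1; have H_gt0 := hHstar n n_ge1.
have rE := sav2_step_auxiliary mOmega dt_neq0 (collision_production hQ Ds)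
  H_gt0 step.
have P_le0 := collision_H_theorem hQ Ds.
set P := Rintegral _ _ _ in rE P_le0 *.
set H := entropy _ _ _ in rE H_gt0 *.
have dissipE : modified_entropy r n.+1 - modified_entropy r n =
    - (1 / 2) * (r n.+1 - 2 * r n + r n.-1) ^+ 2 + dt * r n.+1 ^+ 2 / H * P.
  have -> : dt * r n.+1 ^+ 2 / H * P = r n.+1 * (dt * r n.+1 / H * P) by ring.
  by rewrite -rE bdf2_identity /modified_entropy /=; ring.
split=> //; rewrite dissipE -[leRHS]addr0 lerD//.
  by rewrite mulNr oppr_le0 mulr_ge0// sqr_ge0.
by rewrite mulr_ge0_le0// divr_ge0 ?(ltW H_gt0)// mulr_ge0 ?sqr_ge0// ltW.
Qed.
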